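(* Let $\mathcal{G}$ be a monotone graph class with bounded average degree. Then the following two claims are equivalent: (1) The class $\mathcal{G}$ has bounded domination-to-2-independence ratio. (2) There exists a real number $c$ such that every cascade contained in $\mathcal{G}$ has slope at most $c$.
   Context: Graphs are finite, simple, undirected, and have at least one vertex; graph classes are closed under isomorphism. A graph class is monotone if it is closed under taking (not necessarily induced) subgraphs. It has bounded average degree if there is a constant $t$ such that every graph in the class has average degree at most $t$. For a graph $G$, the domination number $\gamma(G)$ is the minimum size of a set $D\subseteq V(G)$ such that every vertex of $G$ belongs to $D$ or has a neighbor in $D$. The 2-independence number $\alpha_2(G)$ is the maximum size of a set $A\subseteq V(G)$ such that the distance in $G$ between any two distinct vertices of $A$ is greater than two (vertices in different components are at infinite distance). The domination-to-2-independence ratio of a class $\mathcal{G}$ is $\sup_{G\in\mathcal{G}} \gamma(G)/\alpha_2(G)$; it is bounded if this supremum is finite. A cascade is a pair $(H,\psi)$, where $H$ is a graph and $\psi$ is a proper coloring of $H$ by three colors $\mathtt{v},\mathtt{e},\mathtt{d}$ such that every vertex of color $\mathtt{e}$ has exactly two neighbors of color $\mathtt{v}$ and exactly one neighbor of color $\mathtt{d}$, and $H$ has no other edges (i.e. every edge of $H$ is incident with a vertex of color $\mathtt{e}$). A graph class $\mathcal{G}$ contains the cascade $(H,\psi)$ if $H\in\mathcal{G}$. The foundation of the cascade is the graph $F$ with vertex set $\psi^{-1}(\mathtt{v})$ in which two distinct vertices are adjacent if and only if they have a common neighbor in $H$. The slope of the cascade is $$\frac{|\psi^{-1}(\mathtt{v})|}{\max(\alpha(F),|\psi^{-1}(\mathtt{d})|)},$$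 where $\alpha(F)$ is the independence number of $F$. *)

(* Defs.v *)
From HB Require Import structures.
From mathcomp Require Import all_boot all_order all_algebra.
From mathcomp Require Import boolp classical_sets reals ereal.
Set Implicit Arguments.
Unset Strict Implicit.
Unset Printing Implicit Defensive.

Import Order.TTheory GRing.Theory Num.Theory.

(* The vertex set may be empty here, so that the foundation of a cascade
   without vertices of color v is still a graph; members of graph classes are
   required to be nonempty in [graph_class]. *)
Record sgraph := SGraph {
  vertex :> finType;
  adj : rel vertex;
  adj_sym : symmetric adj;
  adj_irrefl : irreflexive adj }.

Definition isomorphic (G H : sgraph) : Prop :=
  exists2 f : G -> H, bijective f & forall x y, adj (f x) (f y) = adj x y.

(* H is a (not necessarily induced) subgraph of G, up to isomorphism. *)
Definition subgraph (H G : sgraph) : Prop :=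
  exists2 f : H -> G, injective f & forall x y, adj x y -> adj (f x) (f y).

Record graph_class := GraphClass {
  in_class :> sgraph -> Prop;
  class_nonempty : forall G, in_class G -> 0 < #|G|;
  class_iso : forall G H, isomorphic G H -> in_class G -> in_class H }.

Definition monotone (C : graph_class) : Prop :=
  forall G H : sgraph, C G -> subgraph H G -> 0 < #|H| -> C H.

Section Invariants.
Variable G : sgraph.
Implicit Types (x y : G) (A D : {set G}).

Definition degree x : nat := #|[set y | adj x y]|.

Definition dominating D : bool :=
  [forall x, (x \in D) || [exists y in D, adj x y]].

(* [setT] is only the witness that a dominating set exists. *)
Definition dom_num : nat := #|[arg min_(D < [set: G] | dominating D) #|D|]|.

Definition independent A : bool :=
  [forall x in A, forall y in A, ~~ adj x y].

Definition indep_num : nat := \max_(A : {set G} | independent A) #|A|.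

Definition walk x y (n : nat) : bool :=
  [exists p : n.-tuple G, path (@adj G) x p && (last x p == y)].

(* [None] stands for infinite distance. *)
Definition dist x y : option nat :=
  if pselect (exists n, walk x y n) is left w then Some (ex_minn w) else None.

Definition dist_gt (k : nat) x y : bool :=
  if dist x y is Some n then k < n else true.

Definition independent2 A : bool :=
  [forall x in A, forall y in A, (x != y) ==> dist_gt 2 x y].

Definition indep2_num : nat := \max_(A : {set G} | independent2 A) #|A|.

End Invariants.

Local Open Scope ring_scope.

Definition avg_degree (R : realType) (G : sgraph) : R :=
  (\sum_(x : G) degree x)%N%:R / #|G|%:R.

Definition bounded_avg_degree (R : realType) (C : graph_class) : Prop :=
  exists t : R, forall G : sgraph, C G -> avg_degree R G <= t.

Definition dom_indep2_ratio (R : realType) (C : graph_class) : \bar R :=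
  ereal_sup (fun r => exists2 G : sgraph, C G &
    r = ((dom_num G)%:R / (indep2_num G)%:R)%:E).

(* The ratios are nonnegative, so the supremum is finite as soon as it is not
   +oo; for the empty class it is -oo, which counts as bounded. *)
Definition bounded_dom_indep2_ratio (R : realType) (C : graph_class) : Prop :=
  (dom_indep2_ratio R C < +oo)%E.

Inductive color := Cv | Ce | Cd.

Definition color_code (c : color) : option bool :=
  match c with Cv => None | Ce => Some true | Cd => Some false end.
Definition color_decode (o : option bool) : color :=
  match o with None => Cv | Some true => Ce | Some false => Cd end.
Lemma color_codeK : cancel color_code color_decode. Proof. by case. Qed.
HB.instance Definition _ := Finite.copy color (can_type color_codeK).

Record cascade := Cascade {
  cgraph :> sgraph;
  ccol : cgraph -> color;
  ccol_proper : forall x y, adj x y -> ccol x != ccol y;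
  ccol_e_v : forall x, ccol x = Ce ->
    #|[set y | adj x y & ccol y == Cv]| = 2%N;
  ccol_e_d : forall x, ccol x = Ce ->
    #|[set y | adj x y & ccol y == Cd]| = 1%N;
  ccol_edges : forall x y, adj x y -> ccol x = Ce \/ ccol y = Ce }.

Section Foundation.
Variable K : cascade.

Definition fvertex : finType := {x : K | ccol x == Cv}.

Definition fadj : rel fvertex := fun u v =>
  (u != v) && [exists w : K, adj (val u) w && adj (val v) w].

Lemma fadj_sym : symmetric fadj.
Proof.
move=> u v; rewrite /fadj eq_sym; congr (_ && _).
by apply: eq_existsb => w; rewrite andbC.
Qed.

Lemma fadj_irrefl : irreflexive fadj.
Proof. by move=> u; rewrite /fadj eqxx. Qed.

Definition foundation : sgraph := SGraph fadj_sym fadj_irrefl.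

Definition slope (R : realType) : R :=
  #|[set x : K | ccol x == Cv]|%:R /
  (maxn (indep_num foundation) #|[set x : K | ccol x == Cd]|)%:R.

End Foundation.

(* Main.v *)
Require Import Defs.
From mathcomp Require Import all_boot all_order all_algebra.
From mathcomp Require Import boolp reals ereal zify ring.
Import Order.TTheory GRing.Theory Num.Theory.

Set Implicit Arguments.
Unset Strict Implicit.
Unset Printing Implicit Defensive.

(** In a cascade a vertex dominates at most two vertices of color v, and a
    2-independent set has at most α(F) vertices of color v and, since it reaches
    distinct vertices of color d, at most |ψ⁻¹(d)| others.  So the slope is at
    most four times the ratio.

    Conversely, orient G with outdegree at most d and call X a T-packing if every
    vertex lies in at most T of the closed out-neighborhoods of X.  If no vertex
    has two out-neighbors in a T-packing X, then the relation "at distance at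
    most two" on X has bounded degeneracy, so |X| = O(α₂).  Hence only the
    conflicts u <- z -> v matter; if the vertices z are dominated by a set D with
    |D| << |X|, the bound on the slopes yields a constant fraction of X without
    such conflicts.

    Let A be a maximal 1-packing; the union D of its closed out-neighborhoods
    dominates G, and |D| = O(|A|).  Let Z be the set of the z with two
    out-neighbors in A, and X a maximal T-packing inside Z, for a large T.
    If |X| >> |A|, then D is small compared to X and dominates everything, so
    |A| <= |X| = O(α₂).  Otherwise the vertices of load T are few compared to A
    and dominate Z outside X; this handles the conflicts with z outside X, and the
    remaining O(|A|) vertices z create only O(|A|) conflicts in A. *)

(** * Large subsets free of a sparse relation *)

Lemma card_bigcup_leq (I T : finType) (P : {set I}) (F : I -> {set T}) (k : nat) :
  (forall i, i \in P -> #|F i| <= k) -> #|\bigcup_(i in P) F i| <= #|P| * k.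
Proof.
move=> leF; rewrite -sum_nat_const.
elim/big_rec2: _ => [|i n A iP leA]; first by rewrite cards0.
by rewrite (leq_trans (leq_card_setU _ _)) // leq_add // leF.
Qed.

Lemma double_count (T U : finType) (X : {set T}) (Y : {set U}) (r : T -> U -> bool) :
  \sum_(x in X) #|[set y in Y | r x y]| = \sum_(y in Y) #|[set x in X | r x y]|.
Proof.
rewrite (eq_bigr (fun x => \sum_(y in Y) r x y)); last first.
  by move=> x _; rewrite -sum1_card big_mkcond [RHS]big_mkcond; apply: eq_bigr => y _;
    rewrite inE; case: (y \in Y); case: (r x y).
rewrite exchange_big; apply: eq_bigr => y _.
by rewrite -sum1_card big_mkcond [RHS]big_mkcond; apply: eq_bigr => x _;
  rewrite inE; case: (x \in X); case: (r x y).
Qed.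

Definition rel_free (T : finType) (r : rel T) (S : {set T}) : Prop :=
  {in S &, forall x y, x != y -> ~~ r x y}.

(** Averaging yields an element with at most [k] relations in each direction. Keeping it and
    discarding its at most [2k] neighbors, recursively, retains one element out of [2k+1]. *)
Lemma out_bounded_free (T : finType) (r : rel T) (k : nat) (X : {set T}) :
  (forall x, x \in X -> #|[set y in X | r x y]| <= k) ->
  exists S : {set T}, [/\ S \subset X, #|X| <= k.*2.+1 * #|S| & rel_free r S].
Proof.
move: {2}#|X| (leqnn #|X|) => n; elim: n X => [|n IHn] X leX outX.
  exists set0; split; first exact: sub0set.
    by rewrite (leq_trans leX).
  by move=> x y; rewrite inE.
have [->|X0] := eqVneq X set0.
  by exists set0; split; rewrite ?cards0 // => x y; rewrite inE.
have [x xX inx] : exists2 x, x \in X & #|[set y in X | r y x]| <= k.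
  apply/exists_inP; apply: contraT; rewrite negb_exists_in => /forall_inP inX.
  have X_gt0 : 0 < #|X| by rewrite card_gt0.
  have : \sum_(x in X) k.+1 <= \sum_(x in X) #|[set y in X | r y x]|.
    by apply: leq_sum => x xX; rewrite ltnNge inX.
  rewrite -(double_count X X r) => le1.
  have : \sum_(x in X) #|[set y in X | r x y]| <= \sum_(x in X) k by apply: leq_sum.
  move/(leq_trans le1); rewrite !sum_nat_const; nia.
pose Y := x |: ([set y in X | r x y] :|: [set y in X | r y x]).
have leY : #|Y| <= k.*2.+1.
  rewrite /Y cardsU1 (leq_trans (leq_add (leq_b1 _) (leq_card_setU _ _)))//.
  by have := outX x xX; lia.
have xY : x \in Y by rewrite !inE eqxx.
have [||S [SX leS freeS]] := IHn (X :\: Y).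
- have : 0 < #|X :&: Y| by rewrite card_gt0; apply/set0Pn; exists x; rewrite inE xX.
  by have := cardsID Y X; lia.
- move=> y /setDP[yX _]; apply: leq_trans (outX y yX); apply: subset_leq_card.
  by apply/subsetP => z; rewrite !inE => /andP[/andP[_ ->] ->].
have xS : x \notin S by apply/negP => /(subsetP SX); rewrite inE xY.
exists (x |: S); split.
- by rewrite subUset sub1set xX (subset_trans SX) ?subsetDl.
- rewrite cardsU1 xS; have := cardsID Y X.
  have := subset_leq_card (subsetIr X Y); lia.
- have nx z : z \in S -> ~~ r x z /\ ~~ r z x.
    move=> /(subsetP SX) /setDP[zX]; rewrite !inE zX /= !negb_or.
    by case/and3P.
  move=> u v /setU1P[->|uS] /setU1P[->|vS]; rewrite ?eqxx // => uv.
  + by case: (nx v vS).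
  + by case: (nx u uS).
  + exact: freeS.
Qed.

(** By Markov's inequality at most half of [X] has more than [2k] out-neighbors. On the rest
    [out_bounded_free] loses a factor [4k+1], hence [8k+2] in total. *)
Lemma sum_bounded_free (T : finType) (r : rel T) (k : nat) (X : {set T}) :
  \sum_(x in X) #|[set y in X | r x y]| <= k * #|X| ->
  exists S : {set T}, [/\ S \subset X, #|X| <= (8 * k + 2) * #|S| & rel_free r S].
Proof.
move=> sumX; pose H := [set x in X | 2 * k < #|[set y in X | r x y]|].
have HX : H \subset X by apply/subsetP => x; rewrite inE => /andP[].
have leH : 2 * #|H| <= #|X|.
  have : \sum_(x in H) (2 * k).+1 <= \sum_(x in X) #|[set y in X | r x y]|.
    rewrite [leqRHS](big_setID H) /= (setIidPr HX); apply: leq_trans (leq_addr _ _).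
    by apply: leq_sum => x; rewrite inE => /andP[].
  rewrite sum_nat_const; nia.
have [|S [SX leS freeS]] := @out_bounded_free T r (2 * k) (X :\: H).
  move=> x /setDP[xX]; rewrite inE xX /= -leqNgt; apply: leq_trans.
  by apply: subset_leq_card; apply/subsetP => y; rewrite !inE => /andP[/andP[_ ->] ->].
exists S; split=> //; first exact: subset_trans SX (subsetDl _ _).
have := cardsID H X; rewrite (setIidPr HX); nia.
Qed.

(** * Distance at most two in terms of adjacency *)

Lemma walk0 (G : sgraph) (x y : G) : walk x y 0 = (x == y).
Proof.
apply/existsP/eqP => [[p]|->]; first by rewrite tuple0 /= => /eqP.
by exists [tuple] => /=.
Qed.

Lemma walk1 (G : sgraph) (x y : G) : walk x y 1 = adj x y.
Proof.
apply/existsP/idP => [[p]|xy]; last by exists [tuple y]; rewrite /= xy eqxx.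
by case/tupleP: p => z p; rewrite tuple0 /= andbT => /andP[xz /eqP <-].
Qed.

Lemma walk2 (G : sgraph) (x y : G) :
  walk x y 2 = [exists w, adj x w && adj w y].
Proof.
apply/existsP/existsP => [[p]|[w /andP[xw wy]]]; last first.
  by exists [tuple w; y]; rewrite /= xw wy eqxx.
case/tupleP: p => w p; case/tupleP: p => z p.
rewrite tuple0 /= andbT => /andP[/andP[xw wz] /eqP zy].
by exists w; rewrite xw -zy.
Qed.

Lemma dist_gt2E (G : sgraph) (x y : G) :
  dist_gt 2 x y = [&& x != y, ~~ adj x y & ~~ [exists w, adj x w && adj w y]].
Proof.
rewrite -walk0 -walk1 -walk2 /dist_gt /dist; case: pselect => [ew|now].
  case: ex_minnP => m wm minm.
  apply/idP/and3P => [m2|[/negP w0 /negP w1 /negP w2]].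
    by split; apply/negP => /minm; lia.
  by case: m wm {minm} => [|[|[|]]].
by symmetry; apply/and3P; split; apply/negP => w; apply: now; eexists; exact: w.
Qed.

(** * Orientations of bounded outdegree *)

Definition orients (G : sgraph) (o : G -> {set G}) (d : nat) : Prop :=
  (forall x y, adj x y = (y \in o x) || (x \in o y)) /\ forall x, #|o x| <= d.

(** Set aside a vertex of low degree, orient the rest by induction, and direct the edges of that
    vertex away from it. *)
Lemma degenerate_orients (G : sgraph) (d : nat) :
  (forall S : {set G}, S != set0 ->
     exists2 x, x \in S & #|[set y in S | adj x y]| <= d) ->
  exists o : G -> {set G}, orients o d.
Proof.
move=> lowdeg.
(* Keeping every [o x] inside [S] ensures that the vertex set aside occurs in no out-neighborhood of
   the recursive orientation. *)
suff orS n (S : {set G}) : #|S| <= n -> exists o : G -> {set G},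
    [/\ {in S &, forall x y, adj x y = (y \in o x) || (x \in o y)},
        forall x, #|o x| <= d & forall x, o x \subset S].
  have [o [oE leo _]] := orS _ [set: G] (leqnn _).
  by exists o; split=> // x y; rewrite oE ?inE.
elim: n S => [|n IHn] S leS.
  move: leS; rewrite leqn0 cards_eq0 => /eqP ->.
  by exists (fun=> set0); split=> [x y|x|x]; rewrite ?inE ?cards0.
have [->|/lowdeg[x xS degx]] := eqVneq S set0.
  by exists (fun=> set0); split=> [y z|y|y]; rewrite ?inE ?cards0.
have [|o [oE leo oS]] := IHn (S :\ x); first by move: leS; rewrite (cardsD1 x) xS.
have xo z : (x \in o z) = false.
  by apply/negP => /(subsetP (oS z)); rewrite !inE eqxx.
exists (fun z => if z == x then [set y in S | adj x y] else o z); split.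
- move=> u v uS vS; have [->|ux] := eqVneq u x; have [->|vx] := eqVneq v x.
  + by rewrite inE xS orbb.
  + by rewrite inE vS xo orbF.
  + by rewrite inE uS xo adj_sym.
  + by rewrite oE // !inE ?ux ?vx.
- by move=> z; case: eqP.
- move=> z; case: eqP => _; last exact: subset_trans (oS z) (subD1set S x).
  by apply/subsetP => y; rewrite inE => /andP[].
Qed.

Section Induced.
Variables (G : sgraph) (S : {set G}).

Definition induced_adj : rel {x : G | x \in S} := fun u v => adj (val u) (val v).

Lemma induced_adj_sym : symmetric induced_adj.
Proof. by move=> u v; apply: adj_sym. Qed.

Lemma induced_adj_irrefl : irreflexive induced_adj.
Proof. by move=> u; apply: adj_irrefl. Qed.

Definition induced : sgraph := SGraph induced_adj_sym induced_adj_irrefl.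

Lemma induced_subgraph : subgraph induced G.
Proof. by exists val; [apply: val_inj|]. Qed.

Lemma card_induced : #|induced| = #|S|.
Proof. by rewrite card_sig. Qed.

Lemma degree_induced (u : induced) : degree u = #|[set y in S | adj (val u) y]|.
Proof.
rewrite /degree -(card_imset _ val_inj); apply: eq_card => y.
apply/imsetP/idP => [[v]|]; first by rewrite !inE => uv ->; rewrite (valP v).
by rewrite inE => /andP[yS uy]; exists (Sub y yS); rewrite ?inE.
Qed.

End Induced.

(** Monotonicity puts the subgraph induced by [S] into the class, and its minimum degree is at most
    its average degree. *)
Lemma class_degenerate (R : realType) (C : graph_class) :
  monotone C -> bounded_avg_degree R C ->
  exists d, forall G : sgraph, C G -> forall S : {set G}, S != set0 ->
    exists2 x, x \in S & #|[set y in S | adj x y]| <= d.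
Proof.
move=> mono [t avgt]; exists (Num.bound `|t|%R) => G CG S S0.
have S_gt0 : 0 < #|induced S| by rewrite card_induced card_gt0.
have := avgt _ (mono _ _ CG (induced_subgraph S) S_gt0).
rewrite /avg_degree ler_pdivrMr ?ltr0n // => sumle.
have /ltW tle := archi_boundP (normr_ge0 t).
have {}sumle : \sum_(x : induced S) degree x <= Num.bound `|t|%R * #|induced S|.
  rewrite -(ler_nat R) natrM; apply: le_trans sumle _.
  by rewrite ler_wpM2r // (le_trans _ tle) // ler_norm.
have [x degx] : exists x : induced S, degree x <= Num.bound `|t|%R.
  apply/existsP; apply: contraT; rewrite negb_exists => /forallP degS.
  have : \sum_(x : induced S) (Num.bound `|t|%R).+1 <= \sum_(x : induced S) degree x.
    by apply: leq_sum => x _; rewrite ltnNge degS.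
  rewrite sum_nat_const => /leq_trans/(_ sumle).
  by rewrite mulnC leq_pmul2r // ltnn.
by exists (val x); [exact: valP | rewrite -degree_induced].
Qed.

(** * Cascades inside graphs of the class *)

Lemma indep_num_witness (G : sgraph) :
  exists2 A : {set G}, independent A & #|A| = indep_num G.
Proof.
have [|A indA EA] := @eq_bigmax_cond _ (@independent G) (fun A : {set G} => #|A|).
  apply/card_gt0P; exists set0; apply/forall_inP => x; by rewrite inE.
by exists A.
Qed.

(** Multiplying out the denominator and taking a natural constant keeps the combinatorial part free
    of real division. *)
Definition slope_bounded (C : graph_class) (c : nat) : Prop :=
  forall K : cascade, C K ->
    #|[set x : K | ccol x == Cv]| <=
      c * maxn (indep_num (foundation K)) #|[set x : K | ccol x == Cd]|.

(* The subgraph on X :|: D :|: E that keeps, for each e in E, only the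
   edges to [p e], [q e] (colored v) and [r e] (colored d). *)
Section TripleCascade.
Variables (G : sgraph) (X D E : {set G}) (p q r : G -> G).
Hypotheses (XD : [disjoint X & D]) (XE : [disjoint X & E]) (DE : [disjoint D & E]).
Hypothesis pq : forall e, e \in E -> p e != q e.
Hypothesis pP : forall e, e \in E -> (p e \in X) && adj e (p e).
Hypothesis qP : forall e, e \in E -> (q e \in X) && adj e (q e).
Hypothesis rP : forall e, e \in E -> (r e \in D) && adj e (r e).

Definition tc_arc (e x : G) : bool := (e \in E) && (x \in [:: p e; q e; r e]).

Definition tc_vertex : finType := {x : G | x \in X :|: D :|: E}.

Definition tc_adj : rel tc_vertex :=
  fun u v => tc_arc (val u) (val v) || tc_arc (val v) (val u).

Lemma tc_arcP e x : tc_arc e x -> [/\ e \in E, x \in X :|: D & adj e x].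
Proof.
case/andP=> eE; have /andP[pX pe] := pP eE; have /andP[qX qe] := qP eE.
have /andP[rD re] := rP eE.
by rewrite !inE => /or3P[] /eqP->; split; rewrite // ?pX ?qX ?rD ?orbT.
Qed.

Lemma tc_notE x : x \in X :|: D -> x \notin E.
Proof. by case/setUP=> [xX|xD]; rewrite ?(disjointFr XE xX) ?(disjointFr DE xD). Qed.

Lemma tc_adj_sym : symmetric tc_adj.
Proof. by move=> u v; rewrite /tc_adj orbC. Qed.

Lemma tc_adj_irrefl : irreflexive tc_adj.
Proof.
move=> u; rewrite /tc_adj orbb; apply/negP => /tc_arcP[_ _].
by rewrite adj_irrefl.
Qed.

Definition tc_graph : sgraph := SGraph tc_adj_sym tc_adj_irrefl.

Definition tc_col (u : tc_graph) : color :=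
  if val u \in X then Cv else if val u \in D then Cd else Ce.

Lemma tc_colv u : (tc_col u == Cv) = (val u \in X).
Proof. by rewrite /tc_col; case: (val u \in X); case: (val u \in D). Qed.

Lemma tc_cold u : (tc_col u == Cd) = (val u \in D).
Proof.
rewrite /tc_col; have [uX|uX] := boolP (val u \in X).
  by rewrite (disjointFr XD uX).
by case: (_ \in D).
Qed.

Lemma tc_cole u : (tc_col u == Ce) = (val u \in E).
Proof.
have := valP u; rewrite !inE /tc_col -orbA => /or3P[uX|uD|uE].
- by rewrite uX (disjointFr XE uX).
- by rewrite (disjointFl XD uD) uD (disjointFr DE uD).
- by rewrite uE (disjointFl XE uE) (disjointFl DE uE).
Qed.

Lemma tc_adjE (u : tc_graph) v : val u \in E -> adj u v = tc_arc (val u) (val v).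
Proof.
move=> uE; rewrite /= /tc_adj orbC.
by case: (boolP (tc_arc (val v) _)) => //= /tc_arcP[_ /tc_notE]; rewrite uE.
Qed.

Lemma tc_proper (u v : tc_graph) : adj u v -> tc_col u != tc_col v.
Proof.
suff arcP (x y : tc_graph) : tc_arc (val x) (val y) -> tc_col x != tc_col y.
  by case/orP => /arcP //; rewrite eq_sym.
case/tc_arcP=> xE /tc_notE yE _; apply: contraNneq yE => xy.
by rewrite -tc_cole -xy tc_cole.
Qed.

Lemma tc_edges (u v : tc_graph) : adj u v -> tc_col u = Ce \/ tc_col v = Ce.
Proof.
by case/orP => /tc_arcP[eE _ _]; [left|right]; apply/eqP; rewrite tc_cole.
Qed.

Lemma tc_val_image (P : pred tc_graph) (Y : {set G}) :
  Y \subset X :|: D :|: E -> (forall u, P u = (val u \in Y)) ->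
  #|[set u | P u]| = #|Y|.
Proof.
move=> /subsetP YU PY; rewrite -(card_imset _ val_inj); apply: eq_card => y.
apply/imsetP/idP => [[u]|yY]; first by rewrite inE PY => uY ->.
by exists (Sub y (YU y yY)); rewrite ?inE ?PY.
Qed.

Lemma tc_e_v (u : tc_graph) :
  tc_col u = Ce -> #|[set v | adj u v & tc_col v == Cv]| = 2.
Proof.
move/eqP; rewrite tc_cole => uE; have /andP[pX _] := pP uE; have /andP[qX _] := qP uE.
have /andP[rD _] := rP uE.
rewrite (@tc_val_image _ [set p (val u); q (val u)]) ?cards2 ?pq //.
  by apply/subsetP => x; rewrite !inE => /orP[] /eqP ->; rewrite ?pX ?qX.
move=> v; rewrite tc_adjE // tc_colv /tc_arc uE !inE.
have [->|_] := eqVneq (val v) (p _); first by rewrite pX.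
have [->|_] := eqVneq (val v) (q _); first by rewrite qX orbT.
by have [->|_] := eqVneq (val v) (r _); rewrite //= (disjointFl XD rD).
Qed.

Lemma tc_e_d (u : tc_graph) :
  tc_col u = Ce -> #|[set v | adj u v & tc_col v == Cd]| = 1.
Proof.
move/eqP; rewrite tc_cole => uE; have /andP[pX _] := pP uE; have /andP[qX _] := qP uE.
have /andP[rD _] := rP uE.
rewrite (@tc_val_image _ [set r (val u)]) ?cards1 //.
  by apply/subsetP => x; rewrite !inE => /eqP ->; rewrite rD orbT.
move=> v; rewrite tc_adjE // tc_cold /tc_arc uE !inE.
have [->|_] := eqVneq (val v) (r _); first by rewrite rD !orbT.
have [->|_] := eqVneq (val v) (p _); first by rewrite (disjointFr XD pX).
by have [->|_] := eqVneq (val v) (q _); rewrite //= (disjointFr XD qX).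
Qed.

Definition triple_cascade : cascade :=
  Cascade tc_proper tc_e_v tc_e_d tc_edges.

Lemma tc_subgraph : subgraph triple_cascade G.
Proof.
exists val; first exact: val_inj.
by move=> u v /orP[] /tc_arcP[_ _]; rewrite // adj_sym.
Qed.

(** [S] is a maximum independent set of the foundation. Since [e] is a common neighbor of [p e] and
    [q e] in the cascade, these two are adjacent in the foundation. *)
Lemma triple_cascade_free (C : graph_class) (c : nat) :
  monotone C -> slope_bounded C c -> C G ->
  exists S : {set G}, [/\ S \subset X, #|X| <= c * maxn #|S| #|D| &
    forall e, e \in E -> ~~ ((p e \in S) && (q e \in S))].
Proof.
(* If [X] is empty, the cascade may have no vertex, and members of the class are nonempty. *)
move=> mono slope CG; have [X0|[x xX]] := set_0Vmem X.
  by exists set0; split; rewrite ?X0 ?cards0 // => e _; rewrite !inE.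
have CK : C triple_cascade.
  apply: (mono G) tc_subgraph _ => //; apply/card_gt0P.
  have xU : x \in X :|: D :|: E by rewrite !inE xX.
  by exists (Sub x xU : tc_vertex).
have [A indA cardA] := indep_num_witness (foundation triple_cascade).
exists [set val (val u) | u in A]; split.
- by apply/subsetP => _ /imsetP[u _ ->]; rewrite -tc_colv (valP u).
- rewrite card_imset; last by move=> u v /val_inj/val_inj.
  have := slope _ CK.
  rewrite (@tc_val_image _ X) ?(@tc_val_image _ D) ?cardA //.
  + by rewrite -setUA setUCA subsetUl.
  + exact: tc_cold.
  + by rewrite -setUA subsetUl.
  + exact: tc_colv.
- move=> e eE; apply/negP => /andP[/imsetP[u uA pu] /imsetP[v vA qv]].
  have /forall_inP/(_ u uA)/forall_inP/(_ v vA)/negP := indA; apply.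
  rewrite /= /fadj; apply/andP; split.
    by apply: contraTneq (pq eE) => uv; rewrite pu qv uv eqxx.
  have eU : e \in X :|: D :|: E by rewrite !inE eE orbT.
  apply/existsP; exists (Sub e eU : tc_vertex).
  by rewrite /= /tc_adj /tc_arc /= eE -pu -qv !inE !eqxx !orbT.
Qed.

End TripleCascade.

(** Each pair in [s] is handled by one cascade at the cost of a factor [c]. The vertices of color e
    are those of [E] whose two images are distinct and have both survived so far. *)
Lemma pairs_free (C : graph_class) (c : nat) (G : sgraph) (D E : {set G})
    (r : G -> G) (f : nat -> G -> G) (s : seq (nat * nat)) (X : {set G}) :
  monotone C -> 0 < c -> slope_bounded C c -> C G ->
  [disjoint X & D] -> [disjoint X & E] -> [disjoint D & E] ->
  (forall e, e \in E -> (r e \in D) && adj e (r e)) ->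
  (forall i e, e \in E -> f i e \in X -> adj e (f i e)) ->
  exists S : {set G}, [/\ S \subset X, #|X| <= c ^ size s * maxn #|S| #|D| &
    forall i j e, (i, j) \in s -> e \in E -> f i e \in S -> f j e \in S ->
      f i e = f j e].
Proof.
move=> mono c_gt0 slope CG + + DE rP; elim: s X => [|[i j] s IHs] X XD XE fP.
  by exists X; split; rewrite // mul1n leq_maxl.
have [//|//|//|S [SX leS freeS]] := IHs X.
pose E' := [set e in E | [&& f i e != f j e, f i e \in S & f j e \in S]].
have E'E : E' \subset E by apply/subsetP => e; rewrite inE => /andP[].
have E'P e : e \in E' -> [/\ e \in E, f i e != f j e, f i e \in S & f j e \in S].
  by rewrite inE => /andP[-> /and3P[]].
have [|||||||S' [S'S leS' freeS']] 
    := @triple_cascade_free G S D E' (f i) (f j) r _ _ _ _ _ _ _ C c mono slope CG.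
- exact: disjointWl SX XD.
- exact: disjointW SX E'E XE.
- exact: disjointWr E'E DE.
- by move=> e /E'P[].
- by move=> e /E'P[eE _ iS _]; rewrite iS fP // (subsetP SX).
- by move=> e /E'P[eE _ _ jS]; rewrite jS fP // (subsetP SX).
- by move=> e /E'P[eE _ _ _]; apply: rP.
exists S'; split; first exact: subset_trans SX.
- rewrite /= expnSr -mulnA; apply: leq_trans leS _.
  rewrite leq_pmul2l ?expn_gt0 ?c_gt0 // geq_max leS' /=.
  by rewrite -[leqLHS]mul1n leq_mul // leq_maxr.
- move=> i' j' e; rewrite inE => /predU1P[[-> ->]|ijs] eE iS jS; last first.
    by apply: freeS ijs eE _ _; apply: (subsetP S'S).
  apply/eqP; apply: contraT => ij.
  have /freeS' : e \in E' by rewrite inE eE ij !(subsetP S'S).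
  by rewrite iS jS.
Qed.

(* A vertex e of a cascade has only two neighbors of color v, so the pairs of
   out-neighbors are separated one pair of positions in [o e] at a time. *)
Lemma out_pairs_free (C : graph_class) (c : nat) (G : sgraph) (o : G -> {set G})
    (d : nat) (X D E : {set G}) :
  monotone C -> 0 < c -> slope_bounded C c -> C G -> orients o d ->
  [disjoint X & D] -> [disjoint X & E] -> [disjoint D & E] ->
  (forall e, e \in E -> exists2 x, x \in D & adj e x) ->
  exists S : {set G}, [/\ S \subset X, #|X| <= c ^ (d * d) * maxn #|S| #|D| &
    forall e, e \in E -> #|o e :&: S| <= 1].
Proof.
move=> mono c_gt0 slope CG [oE leo] XD XE DE domE.
pose r e := odflt e [pick x in D | adj e x].
have rP e : e \in E -> (r e \in D) && adj e (r e).
  move=> /domE[x xD ex]; rewrite /r; case: pickP => [//|/(_ x)].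
  by rewrite xD ex.
(* The default [e] lies outside [X], so a position beyond the end of the list never names a vertex
   of [X]. *)
pose f i e := nth e (enum (o e)) i.
(* One factor [c] for each of these [d * d] pairs of positions gives the exponent. *)
pose s := [seq (i, j) | i <- iota 0 d, j <- iota 0 d].
have [//|//|//|//|i e eE fX|S [SX leS freeS]] := @pairs_free C c G D E r f s X mono c_gt0 slope CG.
  have [lti|gei] := ltnP i (size (enum (o e))).
    by rewrite oE -mem_enum mem_nth.
  by move: fX; rewrite /f nth_default // (disjointFl XE eE).
exists S; split=> //; first by move: leS; rewrite size_allpairs size_iota.
move=> e eE; apply/card_le1_eqP => x y /setIP[xo xS] /setIP[yo yS].
have fK z : z \in o e -> f (index z (enum (o e))) e = z.
  by move=> zo; rewrite /f nth_index ?mem_enum.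
have ltd z : z \in o e -> index z (enum (o e)) \in iota 0 d.
  by move=> zo; rewrite mem_iota add0n (leq_trans _ (leo e)) // cardE index_mem mem_enum.
rewrite -(fK x xo) -(fK y yo); apply: freeS => //; rewrite ?fK //.
by apply: allpairs_f; apply: ltd.
Qed.

(** * Packings and 2-independent sets *)

(** The loss in [out_bounded_free] for a relation of outdegree [(d+1)(d+1+T)], which is the bound
    for [near] in [packing_indep2]. *)
Definition packing_ratio (d T : nat) : nat := (d.+1 * (d.+1 + T)).*2.+1.

Section Packing.
Variables (G : sgraph) (o : G -> {set G}) (d : nat).
Hypothesis oP : orients o d.

Definition closed_out (x : G) : {set G} := x |: o x.

Definition load (X : {set G}) (x : G) : {set G} := [set a in X | x \in closed_out a].

Definition packing (T : nat) (X : {set G}) : bool := [forall x, #|load X x| <= T].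

(** In a packing with bound [T] these vertices have load exactly [T], so they are what blocks an
    extension of the packing. *)
Definition saturated (T : nat) (X : {set G}) : {set G} := [set x | T <= #|load X x|].

Lemma card_closed_out x : #|closed_out x| <= d.+1.
Proof. by rewrite cardsU1 (leq_add (leq_b1 _)) //; case: oP. Qed.

Lemma packingS T (S X : {set G}) : S \subset X -> packing T X -> packing T S.
Proof.
move=> /subsetP SX /forallP packX; apply/forallP => x.
apply: leq_trans (packX x); apply: subset_leq_card.
by apply/subsetP => a; rewrite !inE => /andP[/SX -> ->].
Qed.

(** Double counting of the pairs of some [a] in [X] and a saturated vertex in [closed_out a]. *)
Lemma card_saturated T X : T * #|saturated T X| <= d.+1 * #|X|.
Proof.
have sumT : \sum_(x in saturated T X) T <= \sum_(x in saturated T X) #|load X x|.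
  by apply: leq_sum => x; rewrite inE.
rewrite mulnC -sum_nat_const (leq_trans sumT) // /load.
rewrite -(double_count X (saturated T X) (fun a x => x \in closed_out a)).
rewrite mulnC -sum_nat_const; apply: leq_sum => a _.
apply: leq_trans (card_closed_out a); apply: subset_leq_card.
by apply/subsetP => x; rewrite inE => /andP[].
Qed.

(** If [w] cannot be added to an inclusion-maximal [X], some load would exceed [T]; only loads on
    [closed_out w] grow, and each by at most one. *)
Lemma max_packing T (W : {set G}) :
  exists X : {set G}, [/\ X \subset W, packing T X &
    forall w, w \in W -> w \in X \/ exists2 x, x \in closed_out w & x \in saturated T X].
Proof.
pose P (X : {set G}) := (X \subset W) && packing T X.
have P0 : P set0.
  rewrite /P sub0set; apply/forallP => x; rewrite (_ : load _ _ = set0) ?cards0 //.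
  by apply/setP => a; rewrite !inE.
have [X /maxsetP[/andP[XW packX] maxX] _] := maxset_exists P0.
exists X; split=> // w wW; have [wX|wX] := boolP (w \in X); first by left.
right; apply/exists_inP; apply: contraNT wX => /exists_inPn nsat.
rewrite -(maxX (w |: X)) ?setU11 ?subsetUr // /P subUset sub1set wW XW.
apply/forallP => x; have [xw|xw] := boolP (x \in closed_out w).
  have := nsat x xw; rewrite inE -ltnNge; apply: leq_trans.
  have /subset_leq_card/leq_trans : load (w |: X) x \subset w |: load X x.
    by apply/subsetP => a; rewrite !inE; case: (a == w).
  by apply; rewrite cardsU1 (leq_add (leq_b1 _)).
have /forallP/(_ x) := packX; apply: leq_trans; apply: subset_leq_card.
apply/subsetP => a; rewrite !inE => /andP[/predU1P[->|->//]].
by move: xw; rewrite !inE => /negPf ->.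
Qed.

(** A path of length at most two from [u] to [v] puts [v] in [near u] or [u] in [near v], unless it
    is oriented [u <- w -> v]. A subset of [X] free of [near] is therefore 2-independent. *)
Lemma packing_indep2 T (X : {set G}) :
  packing T X -> (forall z, #|o z :&: X| <= 1) ->
  #|X| <= packing_ratio d T * indep2_num G.
Proof.
move=> /forallP packX outX; have [oE leo] := oP.
pose near u := \bigcup_(w in closed_out u) (closed_out w :|: load X w).
have near_le u : #|near u| <= d.+1 * (d.+1 + T).
  apply: leq_trans (card_bigcup_leq (k := d.+1 + T) _) _.
    by move=> w _; rewrite (leq_trans (leq_card_setU _ _)) // leq_add ?card_closed_out.
  by rewrite leq_mul // card_closed_out.
have [|S [SX leS freeS]] := @out_bounded_free _ (fun u v => v \in near u) (d.+1 * (d.+1 + T)) X.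
  move=> u _; apply: leq_trans (near_le u); apply: subset_leq_card.
  by apply/subsetP => v; rewrite inE => /andP[].
rewrite /packing_ratio; apply: leq_trans leS _; rewrite leq_mul2l; apply/orP; right.
apply: leq_bigmax_cond; apply/forall_inP => u uS; apply/forall_inP => v vS.
apply/implyP => uv; rewrite dist_gt2E uv /=.
have far w x y : x \in S -> y \in S -> x != y -> w \in closed_out x ->
    (y \notin closed_out w) * (w \notin closed_out y).
  move=> xS yS xy wx; have /negP nxy := freeS x y xS yS xy.
  split; apply/negP => wy; apply: nxy; apply/bigcupP; exists w => //.
    by rewrite inE wy.
  by rewrite in_setU [_ \in load _ _]in_set (subsetP SX y yS) wy orbT.
have co x y : y \in o x -> y \in closed_out x by move=> yx; rewrite inE yx orbT.
have co1 x : x \in closed_out x by rewrite inE set11.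
have vu : v != u by rewrite eq_sym.
apply/andP; split.
  rewrite oE; apply/norP; split; apply/negP => /co.
    by apply/negP; case: (far u u v uS vS uv (co1 u)).
  by apply/negP; case: (far v v u vS uS vu (co1 v)).
apply/existsP => -[w]; rewrite !oE => /andP[/orP[wu|uw] /orP[vw|wv]].
- by case: (far w u v uS vS uv (co _ _ wu)); rewrite co.
- by case: (far w u v uS vS uv (co _ _ wu)) => _; rewrite co.
(* The orientation [u <- w -> v], excluded by the assumption on out-neighbors in [X]. *)
- have /card_le1_eqP/(_ u v) := outX w.
  rewrite !inE uw vw !(subsetP SX) // => /(_ isT isT) uE.
  by rewrite uE eqxx in uv.
- by case: (far w v u vS uS vu (co _ _ wv)); rewrite co.
Qed.

End Packing.

(** * Bounds on packings through cascades *)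

Lemma orients_irrefl (G : sgraph) (o : G -> {set G}) d x : orients o d -> x \notin o x.
Proof. by case=> oE _; apply/negP => xx; have := oE x x; rewrite adj_irrefl xx. Qed.

(** Remove from [X] the closed out-neighborhoods of [D], then thin it out to a [Y] without internal
    arcs. Now vertices of [D] and [Y] have no out-neighbor in [Y], and all others can serve as
    vertices of color e, because [D] dominates them. *)
Lemma packing_leq_dominating (C : graph_class) (c : nat) (G : sgraph)
    (o : G -> {set G}) (d T : nat) (X D : {set G}) :
  monotone C -> 0 < c -> slope_bounded C c -> C G -> orients o d ->
  packing o T X -> dominating D ->
  #|X| <= d.+1 * #|D| +
    d.*2.+1 * (c ^ (d * d) * maxn (packing_ratio d T * indep2_num G) #|D|).
Proof.
move=> mono c_gt0 slope CG oP packX /forallP domD; have [oE leo] := oP.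
pose ND := \bigcup_(x in D) closed_out o x.
have leND : #|X :&: ND| <= d.+1 * #|D|.
  apply: leq_trans (subset_leq_card (subsetIr _ _)) _; rewrite mulnC.
  by apply: card_bigcup_leq => x _; apply: card_closed_out.
have [|Y [YX leY freeY]] := @out_bounded_free _ (fun u v => v \in o u) d (X :\: ND).
  move=> u _; apply: leq_trans (leo u); apply: subset_leq_card.
  by apply/subsetP => v; rewrite inE => /andP[].
have YND x y : x \in D -> y \in Y -> y \notin closed_out o x.
  move=> xD /(subsetP YX) /setDP[_]; apply: contra => yx.
  by apply/bigcupP; exists x.
have YD : [disjoint Y & D].
  apply/pred0P => x /=; apply/negP => /andP[/YND xY /xY].
  by rewrite setU11.
have [|||S [SY leS freeS]] :=
    @out_pairs_free C c G o d Y D (~: (Y :|: D)) mono c_gt0 slope CG oP YD.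
- by rewrite disjoints_subset setCK subsetUl.
- by rewrite disjoints_subset setCK subsetUr.
- move=> e; rewrite !inE negb_or => /andP[_ /negPf eD].
  by have := domD e; rewrite eD => /exists_inP.
have oS z : #|o z :&: S| <= 1.
  have [zE|] := boolP (z \in ~: (Y :|: D)); first exact: freeS.
  rewrite inE negbK => zYD; rewrite (_ : o z :&: S = set0) ?cards0 //.
  apply/setP => u; rewrite !inE; apply/negP => /andP[uz /(subsetP SY) uY].
  case/setUP: zYD => [zY|zD].
    have zu : z != u by apply: contraTneq uz => <-; apply: orients_irrefl oP.
    by have /negP := freeY z u zY uY zu.
  by have := YND z u zD uY; rewrite !inE uz orbT.
have SX : S \subset X by apply: subset_trans SY (subset_trans YX (subsetDl _ _)).
have leSa := packing_indep2 oP (packingS SX packX) oS.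
rewrite -(cardsID ND X) leq_add //; apply: leq_trans leY _.
rewrite leq_pmul2l //; apply: leq_trans leS _.
by rewrite leq_pmul2l ?expn_gt0 ?c_gt0 // geq_max !leq_max leSa leqnn orbT.
Qed.

(** A cascade removes the conflicts caused by vertices outside [B] and [D]. Those in [B] or [D] are
    only [O(|A|)] many and cause at most [d * d] conflicts each, so [sum_bounded_free] removes the
    rest. *)
Lemma packing_leq_sparse_pairs (C : graph_class) (c : nat) (G : sgraph)
    (o : G -> {set G}) (d M : nat) (A B D : {set G}) :
  monotone C -> 0 < c -> slope_bounded C c -> C G -> orients o d ->
  packing o 1 A ->
  (forall z, 1 < #|o z :&: A| -> z \in B \/ exists2 x, x \in closed_out o z & x \in D) ->
  (c ^ (d * d) + 2) * #|D| <= #|A| -> #|B| <= M * #|A| ->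
  #|A| <= 2 * c ^ (d * d) * (8 * (d * d * M.+1 * (2 * c ^ (d * d))) + 2) *
    packing_ratio d 1 * indep2_num G.
Proof.
move=> mono c_gt0 slope CG oP packA domZ leD leB; have [oE leo] := oP.
set c1 := c ^ (d * d) in leD *; have c1_gt0 : 0 < c1 by rewrite expn_gt0 c_gt0.
set E := [set z | 1 < #|o z :&: A|] :\: (B :|: D).
(* If [z] in [A] had an out-neighbor [u] in [A], then [u] would have load two. Hence [A] is disjoint
   from [E]. *)
have outA z : z \in A -> o z :&: A = set0.
  move=> zA; apply/setP => u; rewrite !inE; apply/negP => /andP[uz uA].
  have /forallP/(_ u)/card_le1_eqP/(_ z u) := packA.
  rewrite !inE zA uA uz eqxx orbT => /(_ isT isT) uz_eq.
  by move: uz; rewrite uz_eq (negPf (orients_irrefl z oP)).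
have [||||S [SA leS freeS]] :=
    @out_pairs_free C c G o d (A :\: D) D E mono c_gt0 slope CG oP.
- by rewrite disjoints_subset setDE subsetIr.
- apply/pred0P => z /=; apply/negP => /andP[/setDP[zA _]].
  by rewrite !inE outA // cards0 andbF.
- by rewrite disjoints_subset /E setDE setCI setCK setUA subsetUr.
- move=> e /setDP[]; rewrite inE => /domZ[eB|[x xe xD]].
    by rewrite inE eB.
  rewrite inE negb_or => /andP[_ eD]; exists x => //.
  by case/setU1P: xe => [xe|xe]; [rewrite -xe xD in eD | rewrite oE xe].
(* As [D] is so small, the maximum cannot be [#|D|] unless [A] is empty, and [A] loses at most half
   of its vertices to [D]. *)
have {}leS : #|A| <= 2 * c1 * #|S|.
  have := cardsID D A; have := subset_leq_card (subsetIr A D).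
  by move: leS; rewrite -/c1; case: (leqP #|S| #|D|); nia.
pose r u v := [exists z in B :|: D, (u \in o z) && (v \in o z)].
have [|Y [YS leY freeY]] := @sum_bounded_free _ r (d * d * M.+1 * (2 * c1)) S.
  apply: leq_trans (_ : d * (d * #|B :|: D|) <= _); last first.
    have leDA : #|D| <= #|A| by apply: leq_trans leD; rewrite leq_pmull // addn2.
    have leU : #|B :|: D| <= M.+1 * #|A|.
      by apply: leq_trans (leq_card_setU _ _) _; rewrite mulSn addnC leq_add.
    rewrite mulnA -!mulnA leq_mul // leq_mul //.
    by rewrite (leq_trans leU) // leq_mul // mulnA.
  apply: leq_trans (_ : \sum_(u in S) #|[set z in B :|: D | u \in o z]| * d <= _).
    apply: leq_sum => u _.
    apply: leq_trans (card_bigcup_leq (F := o) (k := d) _) => //.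
    apply: subset_leq_card; apply/subsetP => v; rewrite inE => /andP[_].
    case/exists_inP => z zBD /andP[uz vz]; apply/bigcupP; exists z => //.
    by rewrite inE zBD.
  rewrite -big_distrl /= mulnC leq_mul2l; apply/orP; right.
  rewrite (double_count S _ (fun u z => u \in o z)) mulnC -sum_nat_const.
  apply: leq_sum => z _; apply: leq_trans (leo z); apply: subset_leq_card.
  by apply/subsetP => u; rewrite inE => /andP[].
have YA : Y \subset A by apply: subset_trans YS (subset_trans SA (subsetDl _ _)).
have oY z : #|o z :&: Y| <= 1.
  have [zBD|zBD] := boolP (z \in B :|: D).
    apply/card_le1_eqP => u v /setIP[uz uY] /setIP[vz vY].
    apply/eqP/contraT => uv; have /negP := freeY v u vY uY uv; case.
    by apply/exists_inP; exists z; rewrite ?uz ?vz.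
  rewrite leqNgt; apply/negP => z2.
  have zE : z \in E.
    by rewrite in_setD zBD in_set (leq_trans z2) // subset_leq_card // setIS.
  by have := freeS z zE; rewrite leqNgt (leq_trans z2) // subset_leq_card // setIS.
have leYa := packing_indep2 oP (packingS YA packA) oY.
apply: leq_trans leS _; rewrite -!(mulnA (2 * c1)) leq_mul //.
by apply: leq_trans leY _; rewrite -[leqRHS]mulnA leq_mul.
Qed.

(** * Domination number against 2-independence number *)

Lemma dom_num_leq (G : sgraph) (D : {set G}) : dominating D -> dom_num G <= #|D|.
Proof.
move=> domD; rewrite /dom_num; case: arg_minnP => [|D' _ minD]; last exact: minD.
by apply/forallP => x; rewrite inE.
Qed.

Lemma dom_num_witness (G : sgraph) : exists2 D : {set G}, dominating D & #|D| = dom_num G.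
Proof.
rewrite /dom_num; case: arg_minnP => [|D domD _]; last by exists D.
by apply/forallP => x; rewrite inE.
Qed.

Lemma dom_num_leq_indep2 (C : graph_class) (c d : nat) :
  monotone C -> 0 < c -> slope_bounded C c ->
  exists k, forall (G : sgraph) (o : G -> {set G}),
    C G -> orients o d -> dom_num G <= k * indep2_num G.
Proof.
move=> mono c_gt0 slope; set c1 := c ^ (d * d).
(* Up to the last summand, [M * #|A|] pays for the terms in [#|D|] of [packing_leq_dominating],
   where [#|D| <= d.+1 * #|A|]. The summand 1 leaves [#|A|] to be bounded by [k1] times the
   2-independence number. *)
pose M := d.+1 * d.+1 + d.*2.+1 * (c1 * d.+1) + 1.
(* By [card_saturated], [#|X| < M * #|A|] then forces at most [#|A| / (c1 + 2)] saturated vertices.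
   Note that [M] does not depend on [T]. *)
pose T := d.+1 * M * (c1 + 2).
pose k1 := d.*2.+1 * (c1 * packing_ratio d T).
pose k2 := 2 * c1 * (8 * (d * d * M.+2 * (2 * c1)) + 2) * packing_ratio d 1.
exists (d.+1 * (k1 + k2)) => G o CG oP; have [oE leo] := oP.
have [A [_ packA satA]] := max_packing o 1 [set: G].
pose D := saturated o 1 A.
have domD : dominating D.
  apply/forallP => x; apply/orP.
  have satP : x \in A \/ (exists2 y, y \in closed_out o x & y \in D) by apply: satA; rewrite inE.
  have [y yx yD] : exists2 y, y \in closed_out o x & y \in D.
    (* A vertex of [A] contributes to its own load, so it is saturated for the bound 1. *)
    case: satP => // xA; exists x; first exact: setU11.
    by rewrite inE; apply/card_gt0P; exists x; rewrite !inE xA eqxx.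
  case/setU1P: yx => [<-|yx]; [by left|right].
  by apply/exists_inP; exists y; rewrite ?oE ?yx.
have leD : #|D| <= d.+1 * #|A| by have := card_saturated oP 1 A; rewrite mul1n.
suff leA : #|A| <= (k1 + k2) * indep2_num G.
  apply: leq_trans (dom_num_leq domD) (leq_trans leD _).
  by rewrite -mulnA leq_mul.
pose Z := [set z | 1 < #|o z :&: A|].
have [X [XZ packX satX]] := max_packing o T Z.
have [XM|XM] := leqP (M * #|A|) #|X|.
  have := packing_leq_dominating mono c_gt0 slope CG oP packX domD.
  rewrite -/c1; move: XM leD; rewrite /M /k1.
  case: leqP; nia.
have c1_gt0 : 0 < c1 by rewrite expn_gt0 c_gt0.
have leT : (c1 + 2) * #|saturated o T X| <= #|A|.
  have := card_saturated oP T X; rewrite /T.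
  nia.
have := @packing_leq_sparse_pairs C c G o d M.+1 A X (saturated o T X) mono c_gt0 slope CG oP packA.
rewrite -/c1 -/k2 => leA; apply: (leq_trans (leA _ leT _)).
- by move=> z zA; apply: satX; rewrite inE.
- by rewrite (leq_trans (ltnW XM)) // leq_mul.
- by rewrite leq_mul // leq_addl.
Qed.

(** * Domination and 2-independence in a cascade *)

Lemma cascade_dom_num (K : cascade) : #|[set x : K | ccol x == Cv]| <= 2 * dom_num K.
Proof.
have [D /forallP domD <-] := dom_num_witness K.
pose F (x : K) := [set y | ((y == x) || adj x y) && (ccol y == Cv)].
apply: leq_trans (_ : #|\bigcup_(x in D) F x| <= _).
  apply: subset_leq_card; apply/subsetP => y; rewrite inE => yv.
  have /orP[yD|/exists_inP[x xD yx]] := domD y; apply/bigcupP.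
    by exists y; rewrite // inE eqxx.
  by exists x; rewrite // inE adj_sym yx yv orbT.
rewrite mulnC; apply: card_bigcup_leq => x _.
have [xe|xe] := eqVneq (ccol x) Ce.
  rewrite -(ccol_e_v xe); apply: subset_leq_card; apply/subsetP => y; rewrite !inE.
  by case/andP => /predU1P[->|-> ->//]; rewrite xe.
(* A vertex not of color e has only neighbors of color e, so among the vertices of color v it
   dominates at most itself. *)
apply: leq_trans (_ : #|[set x]| <= _); last by rewrite cards1.
apply: subset_leq_card; apply/subsetP => y; rewrite !inE => /andP[/orP[//|xy] /eqP yv].
by have [/eqP|] := ccol_edges xy; [rewrite (negPf xe) | rewrite yv].
Qed.

Lemma cascade_indep2_num (K : cascade) :
  indep2_num K <= 2 * maxn (indep_num (foundation K)) #|[set x : K | ccol x == Cd]|.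
Proof.
apply/bigmax_leqP => A /forall_inP indA.
have far x y : x \in A -> y \in A -> x != y -> dist_gt 2 x y.
  by move=> /indA/forall_inP xA /xA /implyP.
rewrite -(cardsID [set x | ccol x == Cv] A) mul2n -addnn leq_add // leq_max; apply/orP.
  left; pose B := [set u : foundation K | val u \in A].
  have -> : #|A :&: [set x | ccol x == Cv]| = #|B|.
    rewrite -(card_imset _ val_inj); apply: eq_card => x; rewrite !inE.
    apply/andP/imsetP => [[xA xv]|[u uB ->]]; last by move: uB; rewrite inE (valP u).
    by exists (Sub x xv : fvertex K); rewrite // inE.
  apply: leq_bigmax_cond; apply/forall_inP => u; rewrite inE => uA.
  apply/forall_inP => v; rewrite inE => vA; rewrite /= /fadj negb_and negbK.
  have [//|uv /=] := eqVneq u v.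
  have := far _ _ uA vA uv; rewrite dist_gt2E => /and3P[_ _].
  apply: contra => /existsP[w /andP[uw vw]].
  by apply/existsP; exists w; rewrite uw adj_sym.
(* [f] sends a vertex of color e to its neighbor of color d and fixes those of color d. Equal images
   mean distance at most two, so [f] is injective on [A]. *)
right; pose f (x : K) := odflt x [pick y | adj x y & ccol y == Cd].
have fP x : f x = x \/ adj x (f x).
  by rewrite /f; case: pickP => [y /andP[xy _]|_]; [right|left].
rewrite -(@card_in_imset _ _ f (A :\: [set x | ccol x == Cv])).
  apply: subset_leq_card; apply/subsetP => _ /imsetP[x /setDP[_ xv] ->].
  rewrite !inE in xv *; rewrite /f; case: pickP => [y /andP[]//|none] /=.
  have [xe|] := eqVneq (ccol x) Ce.
    have /eqP := ccol_e_d xe; rewrite eq_sym => /eqP xd.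
    have /card_gt0P[y] : 0 < #|[set y | adj x y & ccol y == Cd]| by rewrite -xd.
    by rewrite inE none.
  by case: (ccol x) xv.
move=> x y /setDP[xA _] /setDP[yA _] fxy; apply/eqP/contraT => xy.
have := far x y xA yA xy; rewrite dist_gt2E xy => /and3P[_ /negP nxy /existsP nw].
case: (fP x) (fP y) => fx [] fy.
- by rewrite -fx fxy fy eqxx in xy.
- by case: nxy; rewrite -fx fxy adj_sym.
- by case: nxy; rewrite -fy -fxy.
- by case: nw; exists (f x); rewrite fx fxy adj_sym.
Qed.

Lemma indep_num_gt0 (G : sgraph) (x : G) : 0 < indep_num G.
Proof.
rewrite -(cards1 x); apply: leq_bigmax_cond.
by apply/forall_inP => y /set1P ->; apply/forall_inP => z /set1P ->; rewrite adj_irrefl.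
Qed.

Lemma indep2_num_gt0 (G : sgraph) (x : G) : 0 < indep2_num G.
Proof.
rewrite -(cards1 x); apply: leq_bigmax_cond.
by apply/forall_inP => y /set1P ->; apply/forall_inP => z /set1P ->; rewrite eqxx.
Qed.

(** * Real bounds and the equivalence *)

Local Open Scope ring_scope.

Lemma slope_bounded_nat (R : realType) (C : graph_class) (c : R) :
  (forall K : cascade, C K -> slope K R <= c) -> exists2 b, (0 < b)%N & slope_bounded C b.
Proof.
(* The successor makes the bound positive, as the cancellation of powers of [c] requires. *)
move=> slopec; exists (Num.bound `|c|).+1 => // K CK; have := slopec K CK; rewrite /slope.
set v := #|_|; set m := maxn _ _; have [->//|v_gt0] := posnP v.
(* A vertex of color v makes the foundation nonempty, so the slope is a genuine quotient. *)
have m_gt0 : (0 < m)%N.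
  have /card_gt0P[x] := v_gt0; rewrite inE => xv.
  by rewrite leq_max (indep_num_gt0 (Sub x xv : foundation K)).
rewrite ler_pdivrMr ?ltr0n // => vle; rewrite -(ler_nat R) natrM; apply: le_trans vle _.
rewrite ler_wpM2r // (le_trans (ler_norm c)) // (le_trans (ltW (archi_boundP (normr_ge0 c)))) //.
by rewrite ler_nat.
Qed.

Theorem theorem4 (R : realType) (C : graph_class) (hmono : monotone C)
    (hdeg : bounded_avg_degree R C) :
  bounded_dom_indep2_ratio R C <->
  (exists c : R, forall K : cascade, C K -> slope K R <= c).
Proof.
split=> [ratio|[c /slope_bounded_nat[b b_gt0 slopeb]]].
- have ratio_le (G : sgraph) : C G ->
      (((dom_num G)%:R / (indep2_num G)%:R)%:E <= dom_indep2_ratio R C)%E.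
    by move=> CG; apply: ereal_sup_ubound; exists G.
  have [r supr] : exists r : R, (dom_indep2_ratio R C <= r%:E)%E.
    move: ratio; rewrite /bounded_dom_indep2_ratio.
    (* The value [-oo], the supremum for an empty class, is below any real number. *)
    by case: dom_indep2_ratio => [r _||_]; [exists r | rewrite ltxx | exists 0; rewrite leNye].
  (* One factor 2 comes from [cascade_dom_num], the other from [cascade_indep2_num]. *)
  exists (4 * r) => K CK; have := le_trans (ratio_le K CK) supr; rewrite lee_fin.
  have /card_gt0P[x _] := class_nonempty CK.
  have i_gt0 := indep2_num_gt0 x.
  have := cascade_dom_num K; have := cascade_indep2_num K; rewrite /slope.
  set v := #|[set x : K | ccol x == Cv]|; set m := maxn _ _ => im vd.
  have m_gt0 : (0 < m)%N by lia.
  rewrite !ler_pdivrMr ?ltr0n // => dr.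
  have r_ge0 : 0 <= r.
    by rewrite -(pmulr_lge0 _ (_ : 0 < (indep2_num K)%:R :> R)) ?ltr0n // (le_trans _ dr).
  apply: le_trans (_ : 2 * (dom_num K)%:R <= _); first by rewrite -natrM ler_nat.
  apply: le_trans (_ : 2 * (r * (2 * m)%:R) <= _).
    by rewrite ler_pM2l // (le_trans dr) // ler_wpM2l // ler_nat.
  by rewrite (_ : 2 * (r * (2 * m)%:R) = 4 * r * m%:R) // natrM; ring.
- have [d degC] := class_degenerate hmono hdeg.
  have [k domk] := dom_num_leq_indep2 d hmono b_gt0 slopeb.
  apply: le_lt_trans (ltry k%:R); apply: ge_ereal_sup => _ [G CG ->].
  have [o oP] := degenerate_orients (degC G CG).
  have := domk G o CG oP; rewrite lee_fin.
  (* Division by zero yields 0, which is below [k]. *)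
  have [->|i_gt0] := posnP (indep2_num G); first by rewrite invr0 mulr0.
  by rewrite ler_pdivrMr ?ltr0n // -natrM ler_nat.
Qed.
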